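(* Let $X \subset \mathbb{R}^d$ be compact, let $\nu$ be a (Borel) probability measure on $X$, and write $L^2(X) = L^2(X,\nu)$ for the space of real-valued square-integrable functions. Let $\mathcal{L}: L^2(X) \rightarrow L^2(X)$ be a continuous linear operator. Given $N\in\mathbb{N}$ and a family $\phi=\{\phi_{1},\dots,\phi_{N}\}\subset L^{2}(X)$, define \begin{align*} &\mathcal{P}_{\phi}\colon L^{2}(X)\to\mathbb{R}^{N}, & &\mathcal{P}_{\phi}(g) =\bigl(\langle g,\phi_{1}\rangle,\dots,\langle g,\phi_{N}\rangle\bigr)^{\top},\\ &\mathcal{R}_{\phi}\colon\mathbb{R}^{N}\to L^{2}(X), & &\mathcal{R}_{\phi}(a_{1},\dots,a_{N})=\sum_{j=1}^{N}a_{j}\phi_{j}. \end{align*} Then for each compact set $\mathcal{K} \subset L^2(X)$ and any $0 < \epsilon < 1$ there exist $N > 0$, a neural basis $\phi = \{\phi_1, \phi_2, \dots, \phi_N\}: X \rightarrow \mathbb{R}^N$ and a linear map $\mathcal{G}: \mathbb{R}^N \rightarrow \mathbb{R}^N$ such that the operator $\hat{\mathcal{L}} := \mathcal{R}_{\phi} \circ \mathcal{G} \circ \mathcal{P}_{\phi}$ satisfies $$\sup_{g \in \mathcal{K}} \left\| \mathcal{L}(g) - \hat{\mathcal{L}}(g) \right\|_{L^2(X)} \leq \epsilon.$$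
   Context: $\langle\cdot,\cdot\rangle$ denotes the inner product $\langle f,g\rangle=\int_X f g\,d\nu$ of $L^2(X)=L^2(X,\nu)$, and $\|\cdot\|_{L^2(X)}$ the corresponding norm. Neural basis: a scalar feed-forward neural network is a function $\mathbb{R}^d\to\mathbb{R}$ obtained as a finite composition of affine maps (between Euclidean spaces of arbitrary finite dimensions) and nonlinear activations applied componentwise. The activation function is one of the usual candidates, for instance ReLU, $t\mapsto\max(t,0)$; width and depth are finite but otherwise unrestricted. A collection $\{\phi_1,\dots,\phi_N\}$ of such scalar networks, restricted to $X$ and regarded as elements of $L^2(X)$, is called a neural basis (for the finite-dimensional subspace $V=\operatorname{span}\{\phi_j\}_{j=1}^N\subset L^2(X)$); equivalently, it is the vector-valued network $x\mapsto(\phi_1(x),\dots,\phi_N(x))^\top$ from $X$ to $\mathbb{R}^N$. No orthonormality of the $\phi_j$ is required. *)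

(* Defs.v *)
From HB Require Import structures.
From mathcomp Require Import all_boot all_order all_algebra.
From mathcomp Require Import all_classical all_reals all_analysis.
From mathcomp Require Import measurable_realfun ess_sup_inf.

Set Implicit Arguments.
Unset Strict Implicit.
Unset Printing Implicit Defensive.

Import Order.TTheory GRing.Theory Num.Theory.
Import numFieldNormedType.Exports.

Local Open Scope classical_set_scope.
Local Open Scope ring_scope.

(* [LspaceType mu p1] is the library's type of classes modulo a.e. equality of
   measurable functions with finite p-norm, but it comes with no algebraic or
   topological structure: this section makes it a normed space. *)
Section Lspace_normed_module.
Context d (T : measurableType d) (R : realType).
Variables (mu : {measure set T -> \bar R}) (p : \bar R) (p1 : (1 <= p)%E).
Local Open Scope quotient_scope.

Local Notation Lp := (LspaceType mu p1).
Local Notation mfunq := {mfun_ mu, T >-> measurableTypeR R}.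

HB.instance Definition _ := gen_eqMixin Lp.
HB.instance Definition _ := gen_choiceMixin Lp.

Lemma ae_eq_Lnorm (f g : T -> R) :
  measurable_fun setT f -> measurable_fun setT g -> f = g %[ae mu] ->
  'N[mu]_p[EFin \o f]%E = 'N[mu]_p[EFin \o g]%E.
Proof.
move=> mf mg fg; rewrite unlock /Lnorm; case: p p1 => [r r1|_|//].
- have mpow (h : T -> R) : measurable_fun setT h ->
      measurable_fun setT (fun x => `|(EFin \o h) x| `^ r)%E.
    move=> mh; apply: (@measurableT_comp _ _ _ _ _ _ (fun x : \bar R => x `^ r)%E
      _ (abse \o (EFin \o h))); first exact: measurable_poweR.
    by apply: measurableT_comp => //; exact/measurable_EFinP.
  congr (_ `^ _)%E; apply: ae_eq_integral => //; try exact: mpow.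
  by apply: filterS fg => x fgx /= _; rewrite fgx.
- case: ifPn => // _; apply: eq_ess_sup.
  by apply: filterS fg => x fgx /=; rewrite fgx.
Qed.

Lemma measurable_Lspace (F : Lp) : measurable_fun setT (F : T -> R).
Proof. exact: (@measurable_funPT _ _ _ _ (repr (F : mfunq))). Qed.

Lemma Lfun_Lspace (F : Lp) : (F : T -> R) \in Lfun mu p.
Proof.
apply/andP; split; rewrite inE /=; first exact: measurable_Lspace.
exact: Lebesgue_finite.
Qed.

Lemma measurable_Lfun (f : T -> R) : f \in Lfun mu p -> measurable_fun setT f.
Proof. by move=> /andP[/[!inE]]. Qed.

Section class.
Variables (f : T -> R) (fP : f \in Lfun mu p).

Let f' : T -> measurableTypeR R := f.
Let mf' : measurable_fun setT f'. Proof. exact: measurable_Lfun fP. Qed.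

HB.instance Definition _ := isMeasurableFun.Build _ _ _ _ f' mf'.

Let f'' := [the {mfun T >-> measurableTypeR R} of f'].
Let F : mfunq := \pi_mfunq f''.

Let Ff : (F : T -> R) = f %[ae mu].
Proof.
have : ae_eq_op mu (repr F) f'' by rewrite -eqmodE reprK.
by move=> /asboolP.
Qed.

Let Ffin : finite_norm mu p F.
Proof.
rewrite /finite_norm (ae_eq_Lnorm _ (measurable_Lfun fP) Ff).
  by move: fP => /andP[_ /[!inE]].
exact: (@measurable_funPT _ _ _ _ (repr F)).
Qed.

HB.instance Definition _ := isFinLebesgue.Build d T R mu p p1 F Ffin.

Definition Lclass : Lp := [the Lp of F].

Lemma LclassE : (Lclass : T -> R) = f %[ae mu]. Proof. exact: Ff. Qed.
End class.

Lemma Lspace_eqP (F G : Lp) : (F : T -> R) = G %[ae mu] -> F = G.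
Proof.
case: F G => [F [[Ffin]]] [G [[Gfin]]] /= FG.
have FGE : F = G by apply/eqP; rewrite -[F]reprK -[G]reprK eqmodE; exact/asboolP.
by subst G; rewrite (Prop_irrelevance Ffin Gfin).
Qed.

Lemma eq_Lclass (f g : T -> R) (fP : f \in Lfun mu p) (gP : g \in Lfun mu p) :
  f = g %[ae mu] -> Lclass fP = Lclass gP.
Proof.
move=> fg; apply: Lspace_eqP; have := LclassE gP; have := LclassE fP.
apply: filterS3 fg => x fgx Fx Gx _.
by rewrite Fx// fgx// Gx.
Qed.

Let Lfun0 : (0 : T -> R) \in Lfun mu p.
Proof. by have [] := Lfun_submod_closed mu p1. Qed.

Let LfunDZ a (f g : T -> R) : f \in Lfun mu p -> g \in Lfun mu p ->
  a *: f + g \in Lfun mu p.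
Proof. by have [_] := Lfun_submod_closed mu p1; apply. Qed.

Let LfunZ a (f : T -> R) : f \in Lfun mu p -> a *: f \in Lfun mu p.
Proof. by move=> fP; rewrite -[_ *: _]addr0 LfunDZ. Qed.

Let LfunD (f g : T -> R) : f \in Lfun mu p -> g \in Lfun mu p ->
  f + g \in Lfun mu p.
Proof. by move=> fP gP; rewrite -[f]scale1r LfunDZ. Qed.

Let Lspace0 : Lp := Lclass Lfun0.
Let LspaceD (F G : Lp) : Lp := Lclass (LfunD (Lfun_Lspace F) (Lfun_Lspace G)).
Let LspaceZ a (F : Lp) : Lp := Lclass (LfunZ a (Lfun_Lspace F)).
Let LspaceN (F : Lp) : Lp := LspaceZ (-1) F.

Let L0E : (Lspace0 : T -> R) = 0 %[ae mu]. Proof. exact: LclassE. Qed.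
Let LDE F G : (LspaceD F G : T -> R) = (F : T -> R) + G %[ae mu].
Proof. exact: LclassE. Qed.
Let LZE a F : (LspaceZ a F : T -> R) = a *: (F : T -> R) %[ae mu].
Proof. exact: LclassE. Qed.
Let LNE F : (LspaceN F : T -> R) = (-1) *: (F : T -> R) %[ae mu].
Proof. exact: LclassE. Qed.

Let LspaceDA : associative LspaceD.
Proof.
move=> F G H; apply: Lspace_eqP; near=> x => xT.
rewrite (near (LDE F (LspaceD G H)) x)// (near (LDE (LspaceD F G) H) x)//.
rewrite !fctE (near (LDE G H) x)// (near (LDE F G) x)//.
by rewrite !fctE addrA.
Unshelve. all: by end_near. Qed.

Let LspaceDC : commutative LspaceD.
Proof.
move=> F G; apply: Lspace_eqP; near=> x => xT.
rewrite (near (LDE F G) x)// (near (LDE G F) x)//.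
by rewrite !fctE addrC.
Unshelve. all: by end_near. Qed.

Let Lspace0D : left_id Lspace0 LspaceD.
Proof.
move=> F; apply: Lspace_eqP; near=> x => xT.
rewrite (near (LDE Lspace0 F) x)// !fctE (near L0E x)//.
by rewrite add0r.
Unshelve. all: by end_near. Qed.

Let LspaceND : left_inverse Lspace0 LspaceN LspaceD.
Proof.
move=> F; apply: Lspace_eqP; near=> x => xT.
rewrite (near (LDE (LspaceN F) F) x)// !fctE (near (LNE F) x)// (near L0E x)//.
by rewrite !fctE scaleN1r addNr.
Unshelve. all: by end_near. Qed.

HB.instance Definition _ :=
  GRing.isZmodule.Build Lp LspaceDA LspaceDC Lspace0D LspaceND.

Let LspaceZA a b F : LspaceZ a (LspaceZ b F) = LspaceZ (a * b) F.
Proof.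
apply: Lspace_eqP; near=> x => xT.
rewrite (near (LZE a (LspaceZ b F)) x)// (near (LZE (a * b) F) x)//.
by rewrite !fctE (near (LZE b F) x)// !fctE scalerA.
Unshelve. all: by end_near. Qed.

Let Lspace1Z : left_id 1 LspaceZ.
Proof.
move=> F; apply: Lspace_eqP; near=> x => xT.
by rewrite (near (LZE 1 F) x)// !fctE scale1r.
Unshelve. all: by end_near. Qed.

Let LspaceZDr : right_distributive LspaceZ +%R.
Proof.
move=> a F G; apply: Lspace_eqP; near=> x => xT.
rewrite (near (LZE a (F + G)) x)// !fctE (near (LDE F G) x)//.
rewrite (near (LDE (LspaceZ a F) (LspaceZ a G)) x)// !fctE.
by rewrite (near (LZE a F) x)// (near (LZE a G) x)// !fctE scalerDr.
Unshelve. all: by end_near. Qed.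

Let LspaceZDl F : {morph LspaceZ^~ F : a b / a + b}.
Proof.
move=> a b; apply: Lspace_eqP; near=> x => xT.
rewrite (near (LZE (a + b) F) x)// (near (LDE (LspaceZ a F) (LspaceZ b F)) x)//.
rewrite !fctE (near (LZE a F) x)// (near (LZE b F) x)//.
by rewrite !fctE scalerDl.
Unshelve. all: by end_near. Qed.

HB.instance Definition _ := GRing.Zmodule_isLmodule.Build R Lp
  LspaceZA Lspace1Z LspaceZDr LspaceZDl.

Lemma Lspace0E : ((0 : Lp) : T -> R) = 0 %[ae mu].
Proof. exact: L0E. Qed.

Lemma LspaceDE (F G : Lp) : ((F + G : Lp) : T -> R) = (F : T -> R) + (G : T -> R) %[ae mu].
Proof. exact: LDE. Qed.

Lemma LspaceZE a (F : Lp) : ((a *: F : Lp) : T -> R) = a *: (F : T -> R) %[ae mu].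
Proof. exact: LZE. Qed.

Definition Lspace_norm (F : Lp) : R := fine ('N[mu]_p[EFin \o F])%E.

Let norm_fin (F : Lp) : (Lspace_norm F)%:E = ('N[mu]_p[EFin \o F])%E.
Proof.
rewrite /Lspace_norm fineK// ge0_fin_numE ?Lnorm_ge0//.
exact: Lebesgue_finite.
Qed.

Let normD F G : Lspace_norm (F + G) <= Lspace_norm F + Lspace_norm G.
Proof.
rewrite -lee_fin EFinD !norm_fin.
rewrite (ae_eq_Lnorm _ _ (LspaceDE F G)).
- by apply: eminkowski p1; exact: measurable_Lspace.
- exact: measurable_Lspace.
- by apply: measurable_funD; exact: measurable_Lspace.
Qed.

Let normZ a F : Lspace_norm (a *: F) = `|a| * Lspace_norm F.
Proof.
apply: EFin_inj; rewrite EFinM !norm_fin.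
rewrite (ae_eq_Lnorm _ _ (LspaceZE a F)).
- exact: (LnormZ (Lfun_Sub p1 (Lfun_Lspace F))).
- exact: measurable_Lspace.
- by apply: measurable_funM; [exact: measurable_cst|exact: measurable_Lspace].
Qed.

Let norm_eq0 F : Lspace_norm F = 0 -> F = 0.
Proof.
move=> F0; apply: Lspace_eqP.
have := @fine_Lnormr_eq0 _ _ _ _ _ _ (Lfun_Sub p1 (Lfun_Lspace F)) F0.
by apply: filterS2 L0E => x zx Fx _; exact: etrans (Fx I) (esym (zx I)).
Qed.

HB.instance Definition _ := Lmodule_isNormed.Build R Lp normD normZ norm_eq0.

End Lspace_normed_module.

Section borel_subset.
Context (T : topologicalType) (X : set T) (X0 : X !=set0).

(* Measurable types of the library are pointed, whence the proof [X0], from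
   which nothing but a default point is extracted. *)
Definition nonempty_subtype of X !=set0 : Type := X.

HB.instance Definition _ :=
  Topological.copy (nonempty_subtype X0) (set_type X).
HB.instance Definition _ := isPointed.Build (nonempty_subtype X0)
  (let: exist x Xx := cid X0 in exist _ x (mem_set Xx)).

(* The set X with the Borel sigma-algebra of its subspace topology. *)
Definition borelType := g_sigma_algebraType (@open (nonempty_subtype X0)).
HB.instance Definition _ := Measurable.on borelType.

Definition borelType_val (x : borelType) : T := set_val (x : X).
End borel_subset.

Section activations.
Context {R : realType}.
Implicit Types a t : R.

Definition relu t : R := Num.max t 0.
Definition leaky_relu a t : R := if 0 <= t then t else a * t.
Definition elu a t : R := if 0 <= t then t else a * (expR t - 1).
Definition logistic t : R := (1 + expR (- t))^-1.
Definition tanh t : R := (expR t - expR (- t)) / (expR t + expR (- t)).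
Definition softplus t : R := ln (1 + expR t).
Definition silu t : R := t * logistic t.
Definition gelu t : R := t * fine (normal_prob 0 1 `]-oo, t]).

Inductive usual_activation : (R -> R) -> Prop :=
| usual_relu : usual_activation relu
| usual_leaky_relu a : 0 < a < 1 -> usual_activation (leaky_relu a)
| usual_elu a : 0 < a -> usual_activation (elu a)
| usual_logistic : usual_activation logistic
| usual_tanh : usual_activation tanh
| usual_softplus : usual_activation softplus
| usual_silu : usual_activation silu
| usual_gelu : usual_activation gelu.
End activations.

(* The points of R^n are row vectors. *)
Inductive feedforward (R : realType) (sigma : R -> R) :
  forall m n : nat, ('rV[R]_m -> 'rV[R]_n) -> Prop :=
| ff_affine m n (A : 'M[R]_(m, n)) (b : 'rV[R]_n) :
    feedforward sigma (fun x : 'rV[R]_m => x *m A + b)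
| ff_activation n : feedforward sigma (fun x : 'rV[R]_n => map_mx sigma x)
| ff_comp m n k (f : 'rV[R]_m -> 'rV[R]_n) (g : 'rV[R]_n -> 'rV[R]_k) :
    feedforward sigma f -> feedforward sigma g ->
    feedforward sigma (fun x => g (f x)).

Definition scalar_network (R : realType) (sigma : R -> R) (d : nat)
    (f : 'rV[R]_d -> R) : Prop :=
  exists2 F : 'rV[R]_d -> 'rV[R]_1,
    feedforward sigma F & forall x, f x = F x ord0 ord0.

Section L2.
Context d (T : measurableType d) (R : realType).
Variable nu : {measure set T -> \bar R}.

Definition L2inner (f g : LspaceType2 nu) : R := \int[nu]_x (f x * g x).

Definition coefficients (N : nat) (phi : 'I_N -> LspaceType2 nu)
    (g : LspaceType2 nu) : 'cV[R]_N :=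
  \col_j L2inner g (phi j).

Definition reconstruction (N : nat) (phi : 'I_N -> LspaceType2 nu)
    (a : 'cV[R]_N) : LspaceType2 nu :=
  \sum_(j < N) a j ord0 *: phi j.
End L2.

Definition neural_basis (R : realType) (sigma : R -> R) (d : nat)
    (X : set 'rV[R]_d) (X0 : X !=set0) (nu : probability (borelType X0) R)
    (N : nat) (phi : 'I_N -> LspaceType2 nu) : Prop :=
  forall j, exists2 f : 'rV[R]_d -> R, scalar_network sigma f &
    (phi j : borelType X0 -> R) = f \o @borelType_val _ X X0 %[ae nu].

(* Main.v *)
Require Import Defs.
From HB Require Import structures.
From mathcomp Require Import all_boot all_order all_algebra.
From mathcomp Require Import all_classical all_reals all_analysis.
From mathcomp Require Import measurable_realfun ess_sup_inf.
From mathcomp Require Import ring lra.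

Set Implicit Arguments.
Unset Strict Implicit.
Unset Printing Implicit Defensive.

Import Order.TTheory GRing.Theory Num.Theory.
Import numFieldNormedType.Exports.

Local Open Scope classical_set_scope.
Local Open Scope ring_scope.

(** The operator is approximated by P L P, where P is the orthogonal projection of
L^2 onto a finite-dimensional space V spanned by networks.  Writing P through a
generalized inverse of the Gram matrix of the spanning family puts P L P in the
form R_phi G P_phi with G linear (compression).  If L is bounded by C and V comes
within 2 e of every g in K and within (C + 1) e of every L g, then P being a
contraction that fixes V gives
|L g - P L P g| <= |L g - P L g| + |P L (g - P g)| <= 2 (C + 1) e + 4 C e.
Since K is compact, it is enough that V approximates the points of a finite
e-net of K and their images (compact_compression), so everything rests on the
density of the span of the networks in L^2(X, nu) (neural_density).

Density is obtained from depth rather than from a one-hidden-layer theorem.  Each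
of the usual activations sigma yields, as an affine combination of sigma (t + 1),
sigma t and 1, a function h that is close to the unit step away from 0
(usual_activation_step).  Two layers of h suffice for the indicator of the orthant
of the points x with a_i < x_i for all i: the first layer tests the d inequalities,
the second tests whether all d of them hold.  With steeper and steeper steps these
networks are uniformly bounded and converge pointwise to the indicator
(orthant_network_cvg), hence also in L^2 by dominated convergence.  The orthants
form a pi-system that generates the Borel sets of X, so by Dynkin's theorem the
closed span of the networks contains the indicators of all Borel sets, then the
simple functions, then all of L^2 (closed_subspace_full). *)

(** * Inner product and orthogonal projections in L^2 *)

Section L2_inner_product.
Context d (T : measurableType d) (R : realType).
Variable nu : {measure set T -> \bar R}.
Local Notation L2 := (LspaceType2 nu).
Implicit Types F G H : L2.

Lemma integrable_L2mul F G :
  nu.-integrable [set: T] (EFin \o (fun x => F x * G x)).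
Proof.
by apply/Lfun1_integrable/Lfun2_mul_Lfun1; exact: Lfun_Lspace.
Qed.

(** The values of F + G and a *: F are known only almost everywhere: bilinearity
of the inner product goes through representatives. *)
Lemma eq_L2inner F G (f g : T -> R) :
    measurable_fun [set: T] f -> measurable_fun [set: T] g ->
  (F : T -> R) = f %[ae nu] -> (G : T -> R) = g %[ae nu] ->
  L2inner F G = \int[nu]_x (f x * g x).
Proof.
move=> mf mg Ff Gg; rewrite /L2inner /Rintegral; congr fine.
apply: ae_eq_integral => //.
- by apply/measurable_EFinP/measurable_funM; exact: measurable_Lspace.
- by apply/measurable_EFinP/measurable_funM.
- by apply: filterS2 Ff Gg => x Ffx Ggx _; rewrite Ffx// Ggx.
Qed.

Lemma L2innerC F G : L2inner F G = L2inner G F.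
Proof. by apply: eq_Rintegral => x _; rewrite mulrC. Qed.

Lemma L2innerDl F G H : L2inner (F + G) H = L2inner F H + L2inner G H.
Proof.
rewrite -RintegralD//; [|exact: integrable_L2mul..].
rewrite (eq_L2inner (f := (F : T -> R) + G) (g := H)) //.
- by apply: eq_Rintegral => x _; rewrite -mulrDl.
- by apply: measurable_funD; exact: measurable_Lspace.
- exact: measurable_Lspace.
- exact: LspaceDE.
- exact: aeW.
Qed.

Lemma L2innerZl a F H : L2inner (a *: F) H = a * L2inner F H.
Proof.
rewrite -RintegralZl//; last exact: integrable_L2mul.
rewrite (eq_L2inner (f := a *: (F : T -> R)) (g := H)) //.
- by apply: eq_Rintegral => x _; rewrite mulrA.
- by apply: measurable_funM; [exact: measurable_cst|exact: measurable_Lspace].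
- exact: measurable_Lspace.
- exact: LspaceZE.
- exact: aeW.
Qed.

Lemma L2innerNl F H : L2inner (- F) H = - L2inner F H.
Proof. by rewrite -scaleN1r L2innerZl mulN1r. Qed.

Lemma L2innerBl F G H : L2inner (F - G) H = L2inner F H - L2inner G H.
Proof. by rewrite L2innerDl L2innerNl. Qed.

Lemma L2inner0l H : L2inner 0 H = 0.
Proof. by rewrite -(subrr H) L2innerBl subrr. Qed.

Lemma L2inner_suml I (r : seq I) (P : pred I) (F : I -> L2) H :
  L2inner (\sum_(i <- r | P i) F i) H = \sum_(i <- r | P i) L2inner (F i) H.
Proof.
apply: (@big_morph _ _ (fun F => L2inner F H)) => [G K|].
  exact: L2innerDl.
exact: L2inner0l.
Qed.

Lemma Lspace2_norm_sqr F : (`|F| ^+ 2)%:E = (\int[nu]_x (F x ^+ 2)%:E)%E.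
Proof.
have NF : (`|F|)%:E = ('N[nu]_2%:E[EFin \o F])%E.
  by rewrite fineK// ge0_fin_numE ?Lnorm_ge0//; exact: Lebesgue_finite.
have := @poweR_Lnorm _ _ _ nu (EFin \o F) 2 (lt0r_neq0 (ltr0Sn R 1)).
rewrite -NF poweR_EFin powR_mulrn ?normr_ge0// => ->.
by apply: eq_integral => x _ /=; rewrite powR_mulrn// real_normK ?num_real.
Qed.

Lemma L2inner_norm F : L2inner F F = `|F| ^+ 2.
Proof.
apply: EFin_inj; rewrite Lspace2_norm_sqr -[RHS]fineK; last first.
  by rewrite -Lspace2_norm_sqr.
by rewrite /L2inner /Rintegral; congr (fine _)%:E; apply: eq_integral.
Qed.

Lemma L2inner_eq0 F : L2inner F F = 0 -> F = 0.
Proof. by rewrite L2inner_norm => /eqP; rewrite sqrf_eq0 normr_eq0 => /eqP. Qed.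

Section projection.
Variables (N : nat) (phi : 'I_N -> L2).

Lemma coefficients_is_linear : linear (coefficients phi).
Proof.
by move=> a F G; apply/colP => j; rewrite !mxE L2innerDl L2innerZl.
Qed.

HB.instance Definition _ :=
  GRing.isLinear.Build R L2 'cV[R]_N _ (coefficients phi) coefficients_is_linear.

Lemma reconstruction_is_linear : linear (reconstruction phi).
Proof.
move=> c a b; rewrite /reconstruction scaler_sumr -big_split/=.
by apply: eq_bigr => j _; rewrite !mxE scalerDl scalerA.
Qed.

HB.instance Definition _ := GRing.isLinear.Build R 'cV[R]_N L2 _
  (reconstruction phi) reconstruction_is_linear.

Lemma L2inner_reconstruction (a : 'cV[R]_N) F :
  L2inner (reconstruction phi a) F = (a^T *m coefficients phi F) ord0 ord0.
Proof.
rewrite L2inner_suml mxE; apply: eq_bigr => j _.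
by rewrite L2innerZl !mxE L2innerC.
Qed.

Definition gram : 'M[R]_N := \matrix_(i, j) L2inner (phi i) (phi j).

Lemma trmx_gram : gram^T = gram.
Proof. by apply/matrixP => i j; rewrite !mxE L2innerC. Qed.

Lemma coefficients_reconstruction (a : 'cV[R]_N) :
  coefficients phi (reconstruction phi a) = gram *m a.
Proof.
apply/colP => j; rewrite !mxE L2inner_suml; apply: eq_bigr => i _.
by rewrite L2innerZl !mxE mulrC L2innerC.
Qed.

(** For Q a generalized inverse of the Gram matrix this is the orthogonal
projection onto the span of phi, even when the phi_j are linearly dependent. *)
Definition gram_operator (Q : 'M[R]_N) F : L2 :=
  reconstruction phi (Q *m coefficients phi F).

Lemma gram_operator_is_linear Q : linear (gram_operator Q).
Proof. by move=> a F G; rewrite /gram_operator !(linearP, mulmxDr, scalemxAr). Qed.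

HB.instance Definition _ Q := GRing.isLinear.Build R L2 L2 _
  (gram_operator Q) (gram_operator_is_linear Q).

(** The difference of both sides lies in the span of phi, and M Q M = M says that
it is orthogonal to that span. *)
Lemma gram_operator_fix Q (a : 'cV[R]_N) : gram *m Q *m gram = gram ->
  gram_operator Q (reconstruction phi a) = reconstruction phi a.
Proof.
move=> MQM; rewrite /gram_operator coefficients_reconstruction.
apply/eqP; rewrite -subr_eq0 -linearB/=; apply/eqP/L2inner_eq0.
rewrite L2inner_reconstruction coefficients_reconstruction mulmxBr !mulmxA MQM.
by rewrite subrr mulmx0 mxE.
Qed.

Lemma L2inner_gram_operator Q F H :
  L2inner (gram_operator Q F) H = L2inner F (gram_operator Q^T H).
Proof.
rewrite (L2innerC F) !L2inner_reconstruction.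
transitivity (((coefficients phi H)^T *m Q *m coefficients phi F)^T ord0 ord0).
  by congr (fun_of_matrix _ _ _); rewrite !trmx_mul trmxK mulmxA.
by rewrite mxE trmx_mul trmxK.
Qed.

Definition gram_projection : L2 -> L2 := gram_operator (pinvmx gram).

HB.instance Definition _ := GRing.Linear.on gram_projection.

Let gram_pinv : gram *m pinvmx gram *m gram = gram.
Proof. exact: mulmxKpV. Qed.

Let gram_pinvT : gram *m (pinvmx gram)^T *m gram = gram.
Proof. by rewrite -{1 3}trmx_gram -!trmx_mul mulmxA gram_pinv trmx_gram. Qed.

Lemma gram_projection_fix (a : 'cV[R]_N) :
  gram_projection (reconstruction phi a) = reconstruction phi a.
Proof. exact: gram_operator_fix. Qed.

Lemma gram_projection_basis j : gram_projection (phi j) = phi j.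
Proof.
have -> : phi j = reconstruction phi (delta_mx j ord0).
  rewrite /reconstruction (bigD1 j)//= big1 ?addr0 => [|i /negPf ij].
    by rewrite mxE !eqxx scale1r.
  by rewrite mxE ij scale0r.
exact: gram_projection_fix.
Qed.

(** The residual F - P F is orthogonal to P F: the adjoint of P is built from the
transpose of Q, which is again a generalized inverse of the symmetric matrix M and
so fixes P F.  The bound is then Pythagoras' theorem. *)
Lemma gram_projection_le F : `|gram_projection F| <= `|F|.
Proof.
rewrite -(ler_pXn2r (n := 2))// ?nnegrE ?normr_ge0// -!L2inner_norm.
set P := gram_projection F.
have orth : L2inner (F - P) P = 0.
  rewrite L2innerBl [L2inner P P](L2inner_gram_operator _ F).
  by rewrite gram_operator_fix ?subrr.
have -> : L2inner F F = L2inner (F - P) (F - P) + L2inner P P.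
  have {1 2}-> : F = (F - P) + P by rewrite subrK.
  move: (F - P) orth => E orth.
  by rewrite L2innerDl !(L2innerC _ (E + P)) !L2innerDl (L2innerC P E) orth
    addr0 add0r.
by rewrite lerDr L2inner_norm sqr_ge0.
Qed.

(** Because F - P F = (F - G) - P (F - G), any G in the range of P bounds the
distance from F to its projection. *)
Lemma gram_projection_dist F G : gram_projection G = G ->
  `|F - gram_projection F| <= 2 * `|F - G|.
Proof.
move=> PG; have -> : F - gram_projection F =
    (F - G) - gram_projection (F - G) by rewrite linearB/= PG opprB addrA subrK.
rewrite (le_trans (ler_normB _ _))// mulr_natl [leRHS]mulr2n lerD2l.
exact: gram_projection_le.
Qed.

End projection.
End L2_inner_product.

(** * Dense subspaces of L^2 *)

Section L2_density.
Context d (T : measurableType d) (R : realType).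
Variable nu : {finite_measure set T -> \bar R}.
Local Notation L2 := (LspaceType2 nu).

Lemma Lfun2_dominated (f g : T -> R) : measurable_fun [set: T] f ->
  (forall x, `|f x| <= `|g x|) -> g \in Lfun nu 2%:E -> f \in Lfun nu 2%:E.
Proof.
move=> mf fg g2.
apply/andP; split; rewrite inE//=.
move: (g2) => /andP[_ /[!inE]/=]; apply: le_lt_trans; rewrite unlock.
rewrite gt0_ler_poweR ?in_itv/= ?leey ?integral_ge0// ?invr_ge0//.
have mpow (h : T -> R) : measurable_fun setT h ->
    measurable_fun setT (fun x => `|(EFin \o h) x| `^ 2)%E.
  move=> mh; apply: (@measurableT_comp _ _ _ _ _ _ (fun x : \bar R => x `^ 2)%E
    _ (abse \o (EFin \o h))); first exact: measurable_poweR.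
  by apply: measurableT_comp => //; exact/measurable_EFinP.
apply: ge0_le_integral => //; try exact: mpow.
- exact: (mpow g (measurable_Lfun g2)).
- move=> x _ /=; by rewrite lee_fin ge0_ler_powR ?nnegrE.
Qed.

Lemma Lfun2_bounded (f : T -> R) (M : R) : measurable_fun [set: T] f ->
  (forall x, `|f x| <= M) -> f \in Lfun nu 2%:E.
Proof.
move=> mf fM; apply: (Lfun2_dominated mf (g := cst M)) => [x|].
  exact: le_trans (fM x) (ler_norm _).
exact: Lfun_cst.
Qed.

(** Dominated convergence of (u_n - v)^2, with dominating function 4 g^2.  The
conclusion quantifies over the classes F and G because only their almost
everywhere values are at hand. *)
Lemma dominated_cvg_L2 (u : nat -> T -> R) (v g : T -> R) :
    (forall n, measurable_fun [set: T] (u n)) -> g \in Lfun nu 2%:E ->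
    (forall n x, `|u n x| <= g x) -> (forall x, u n x @[n --> \oo] --> v x) ->
  forall e : R, 0 < e -> exists n, forall F G : L2,
    (F : T -> R) = u n %[ae nu] -> (G : T -> R) = v %[ae nu] -> `|F - G| < e.
Proof.
move=> mu g2 ug uv e e0.
have mv : measurable_fun [set: T] v.
  by apply: (measurable_fun_cvg (h := u)) => // x _; exact: uv.
have vg x : `|v x| <= g x.
  by apply: (cvgr_to_le (cvg_norm (uv x))); exact: nearW.
have mDsq n : measurable_fun [set: T] (fun x => (u n x - v x) ^+ 2).
  by apply: measurable_funX; exact: measurable_funB.
have g4 : nu.-integrable [set: T] (fun x => (4 * g x ^+ 2)%:E).
  apply: (eq_integrable measurableT (fun x => 4%:E * (g x ^+ 2)%:E)%E).
    by move=> x _; rewrite EFinM.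
  exact: integrableZl (Lfun2_integrable_sqr g2).
have Dsq0 : (\int[nu]_x ((u n x - v x) ^+ 2)%:E)%E @[n --> \oo] --> 0%E.
  rewrite -(@integral0 _ _ _ nu [set: T]).
  apply: (@dominated_cvg _ _ _ nu [set: T] measurableT
      (fun n x => ((u n x - v x) ^+ 2)%:E) (cst 0%E)
      (fun x => (4 * g x ^+ 2)%:E)) => //.
  - by move=> n; exact/measurable_EFinP.
  - move=> x _ /=; apply: cvg_EFin; first exact: nearW.
    have uvx : u n x - v x @[n --> \oo] --> v x - v x.
      exact: cvgB (uv x) (cvg_cst _).
    suff : (u n x - v x) ^+ 2 @[n --> \oo] --> (0 : R) by [].
    under eq_fun do rewrite expr2.
    have -> : (0 : R) = (v x - v x) * (v x - v x) by rewrite subrr mulr0.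
    by apply: cvgM; exact: uvx.
  - move=> n x _; rewrite gee0_abs ?lee_fin ?sqr_ge0//.
    rewrite (_ : 4 * g x ^+ 2 = (g x + g x) ^+ 2); last by ring.
    rewrite -[leLHS]real_normK ?num_real// lerXn2r ?nnegrE//.
      by rewrite addr_ge0 ?(le_trans _ (vg x)).
    by rewrite (le_trans (ler_normB _ _))// lerD.
have : fine (\int[nu]_x ((u n x - v x) ^+ 2)%:E)%E @[n --> \oo] --> (0 : R).
  exact: (fine_cvg Dsq0).
move=> /cvgrPdist_lt/(_ _ (exprn_gt0 2 e0)) [n _ /(_ n (leqnn n)) /= Dsqn].
exists n => F G Fu Gv; rewrite -(ltr_pXn2r (n := 2)) ?nnegrE ?normr_ge0 ?(ltW e0)//.
have FGE : ((F - G : L2) : T -> R) = (fun x => u n x - v x) %[ae nu].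
  have := LspaceZE (-1) G; rewrite scaleN1r => NGE.
  have BE : ((F - G : L2) : T -> R) = (fun x => F x - G x) %[ae nu].
    apply: filterS2 (LspaceDE F (- G)) NGE => x FE GE xT.
    by rewrite FE// !fctE GE// !fctE scaleN1r.
  by apply: filterS3 BE Fu Gv => x BE Fu Gv xT; rewrite BE// Fu// Gv.
have DsqE : (`|F - G| ^+ 2)%:E = (\int[nu]_x ((u n x - v x) ^+ 2)%:E)%E.
  rewrite Lspace2_norm_sqr; apply: ae_eq_integral => //.
  - apply/measurable_EFinP/measurable_funX; exact: measurable_Lspace.
  - exact/measurable_EFinP.
  - by apply: filterS FGE => x FGE xT; rewrite FGE.
by rewrite -DsqE /= sub0r normrN ger0_norm ?sqr_ge0// in Dsqn.
Qed.

Section closed_subspace.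
Variable S : set L2.
Hypothesis S_linear : forall a F G, S F -> S G -> S (a *: F + G).
Hypothesis S_closed : forall F,
  (forall e : R, 0 < e -> exists2 G, S G & `|G - F| < e) -> S F.

(** Membership in S of the class of f, stated for functions so that pointwise
arguments apply; square integrability of f comes with the witness F. *)
Definition represented (f : T -> R) :=
  exists2 F : L2, S F & (F : T -> R) = f %[ae nu].

Lemma represented_lin a f g :
  represented f -> represented g -> represented (fun x => a * f x + g x).
Proof.
move=> [F SF Ff] [G SG Gg]; exists (a *: F + G); first exact: S_linear.
have FGE : ((a *: F + G : L2) : T -> R) = (fun x => a * F x + G x) %[ae nu].
  apply: filterS2 (LspaceDE (a *: F) G) (LspaceZE a F) => x DE ZE xT.
  by rewrite DE// !fctE ZE.
by apply: filterS3 FGE Ff Gg => x FGE Ff Gg xT; rewrite FGE// Ff// Gg.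
Qed.

Lemma represented_cvg (u : nat -> T -> R) (v g : T -> R) :
    (forall n, represented (u n)) -> (forall n, measurable_fun [set: T] (u n)) ->
    g \in Lfun nu 2%:E -> (forall n x, `|u n x| <= g x) ->
  (forall x, u n x @[n --> \oo] --> v x) -> represented v.
Proof.
move=> ru mu g2 ug uv.
have mv : measurable_fun [set: T] v.
  by apply: (measurable_fun_cvg (h := u)) => // x _; exact: uv.
have vg x : `|v x| <= g x.
  by apply: (cvgr_to_le (cvg_norm (uv x))); exact: nearW.
have vg' x := le_trans (vg x) (ler_norm _).
pose V : L2 := Lclass _ (Lfun2_dominated mv vg' g2).
have Vv : (V : T -> R) = v %[ae nu] by exact: LclassE.
exists V => //; apply: S_closed => e e0.
have [n un] := dominated_cvg_L2 mu g2 ug uv e0.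
by have [F SF Fu] := ru n; exists F => //; exact: un.
Qed.

Hypothesis represented1 : represented (cst 1).

Lemma represented0 : represented (cst 0).
Proof.
rewrite (_ : cst 0 = fun x => -1 * cst 1 x + cst 1 x).
  exact: represented_lin.
by apply/funext => x /=; rewrite mulN1r addNr.
Qed.

Lemma represented_sum n (f : 'I_n -> T -> R) :
  (forall i, represented (f i)) -> represented (fun x => \sum_(i < n) f i x).
Proof.
elim: n f => [|n ih] f rf.
  by under eq_fun do rewrite big_ord0; exact: represented0.
under eq_fun do rewrite big_ord_recl -[X in X + _]mul1r.
by apply: represented_lin => //; exact: ih.
Qed.

(** Increasing unions are where closedness of S enters: the indicators converge
pointwise and are bounded by 1, which is square integrable for a finite measure. *)
Lemma represented_indic_lambda :
  lambda_system [set: T] [set A | measurable A /\ represented (\1_A)].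
Proof.
split => [//||A B BA [mA rA] [mB rB]|A ndA A_].
- by split => //; rewrite indicT.
- split; first exact: measurableD.
  rewrite (_ : \1_(A `\` B) = fun x => -1 * \1_B x + \1_A x).
    exact: represented_lin.
  apply/funext => x.
  rewrite !indicE in_setD mulN1r addrC.
  case: (boolP (x \in B)) => xB; last by rewrite subr0 andbT.
  by rewrite andbF (_ : x \in A) ?subrr// inE; apply: BA; rewrite inE in xB.
- split; first by apply: bigcup_measurable => k _; case: (A_ k).
  apply: (@represented_cvg (fun n => \1_(A n)) _ (cst 1)).
  + by move=> n; case: (A_ n).
  + by move=> n; apply: measurable_indic; case: (A_ n).
  + exact: Lfun_cst.
  + by move=> n x; rewrite indicE ger0_norm ?ler0n// lern1 leq_b1.
  + move=> x; rewrite !indicE.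
    case: (boolP (x \in _)) => xA.
      move: xA; rewrite inE => -[k _ Akx].
      apply: cvg_near_cst; exists k => //= n kn.
      by rewrite indicE mem_set//; have /subsetPset := ndA _ _ kn; exact.
    apply: cvg_near_cst; apply: nearW => n; rewrite indicE memNset//.
    by apply: contraNnot xA => Anx; rewrite inE; exists n.
Qed.

Variable G : set (set T).
Hypothesis G_setI : setI_closed G.
Hypothesis G_gen : measurable `<=` <<s G >>.
Hypothesis G_represented : forall A, G A -> measurable A /\ represented (\1_A).

Lemma represented_indic A : measurable A -> represented (\1_A).
Proof.
move=> /G_gen; have H := represented_indic_lambda.
by move=> /(lambda_system_subset G_setI H G_represented)[].
Qed.

Import HBNNSimple.

Lemma represented_nnsfun (f : {nnsfun T >-> R}) : represented f.
Proof.
rewrite (funext (fimfunEord f)); apply: represented_sum => i; move: (_`_i) => y.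
set A := f @^-1` _.
rewrite (_ : (fun x => _) = fun x => y * \1_A x + cst 0 x).
  apply: represented_lin; last exact: represented0.
  exact/represented_indic/measurable_sfunP.
by apply/funext => x; rewrite addr0.
Qed.

(** The standard simple approximations of f >= 0 stay below f, which serves as its
own dominating function. *)
Lemma represented_ge0 f : f \in Lfun nu 2%:E -> (forall x, 0 <= f x) ->
  represented f.
Proof.
move=> f2 f0; have mf := measurable_Lfun f2.
have mEf : measurable_fun [set: T] (EFin \o f) by exact/measurable_EFinP.
have f0E x : [set: T] x -> (0 <= (EFin \o f) x)%E by move=> _; rewrite lee_fin.
apply: (represented_cvg (u := fun n => nnsfun_approx measurableT mEf n) _ _ f2).
- by move=> n; exact: represented_nnsfun.
- by move=> n; exact: measurable_funPT.
- move=> n x; rewrite ger0_norm; last exact: fun_ge0.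
  by rewrite nnsfun_approxE -lee_fin; exact: (le_approx _ f0E).
- move=> x; exact: (fine_cvg (cvg_nnsfun_approx measurableT mEf f0E I)).
Qed.

(** A closed subspace of L^2 that contains the constants and the indicators of a
generating pi-system is the whole space. *)
Lemma closed_subspace_full F : S F.
Proof.
suff : represented F by move=> [H SH /Lspace_eqP <-].
have F2 := Lfun_Lspace F; have mF := measurable_Lspace F.
rewrite (_ : (F : T -> R) = fun x => -1 * F^\- x + F^\+ x); last first.
  by apply/funext => x; rewrite mulN1r addrC -[in LHS](funrposBneg F).
have mFp : measurable_fun [set: T] F^\+ by exact: measurable_funrpos.
have mFn : measurable_fun [set: T] F^\- by exact: measurable_funrneg.
have FpDn x : `|F x| = F^\+ x + F^\- x by rewrite -[RHS]/((F^\+ + F^\-) x) funrposDneg.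
apply: represented_lin; apply: represented_ge0 => //.
- apply: (Lfun2_dominated mFn _ F2) => x; rewrite FpDn ger0_norm ?funrneg_ge0//.
  by rewrite lerDr funrpos_ge0.
- apply: (Lfun2_dominated mFp _ F2) => x; rewrite FpDn ger0_norm ?funrpos_ge0//.
  by rewrite lerDl funrneg_ge0.
Qed.
End closed_subspace.
End L2_density.

(** * Activations as approximate steps *)

Section activations_are_step_like.
Context {R : realType}.
Implicit Types (f r : R -> R) (s t : R).

Definition heaviside t : R := (0 <= t)%R%:R.

(** Decay at rate 1 / (1 + |t|) is weak enough for the increments of all the
activations, whereas being a single inequality it is stable under shifts and
linear combinations without any limit at infinity. *)
Definition decaying r := measurable_fun [set: R] r /\
  exists M : R, forall t, (1 + `|t|) * `|r t| <= M.

Definition step_like f := decaying (fun t => f t - heaviside t).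

Lemma measurable_heaviside : measurable_fun [set: R] heaviside.
Proof.
rewrite (_ : heaviside = \1_(`[(0 : R), +oo[%classic)); first exact: measurable_indic.
by apply/funext => t; rewrite indicE mem_setE in_itv/= andbT.
Qed.

Lemma decaying_lin a r r' : decaying r -> decaying r' ->
  decaying (fun t => a * r t + r' t).
Proof.
move=> [mr [M rM]] [mr' [N rN]]; split.
  by apply: measurable_funD => //; exact: measurable_funM.
exists (`|a| * M + N) => t; have t0 : 0 <= 1 + `|t| by rewrite addr_ge0.
apply: (@le_trans _ _ (`|a| * ((1 + `|t|) * `|r t|) + (1 + `|t|) * `|r' t|)).
  by rewrite mulrCA -mulrDr ler_wpM2l// -normrM ler_normD.
by apply: lerD => //; exact: ler_wpM2l.
Qed.

Lemma decaying0 : decaying (cst 0).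
Proof. by split => //; exists 0 => t; rewrite normr0 mulr0. Qed.

Lemma decayingZ a r : decaying r -> decaying (fun t => a * r t).
Proof.
move=> dr; rewrite (_ : (fun t => _) = fun t => a * r t + cst 0 t).
  exact: decaying_lin dr decaying0.
by apply/funext => t; rewrite addr0.
Qed.

Lemma decayingD r r' : decaying r -> decaying r' ->
  decaying (fun t => r t + r' t).
Proof.
move=> dr dr'; rewrite (_ : (fun t => _) = fun t => 1 * r t + r' t).
  exact: decaying_lin.
by apply/funext => t; rewrite mul1r.
Qed.

(** The weight 1 + |t| at most doubles under a shift by 1. *)
Lemma decaying_shift r : decaying r -> decaying (fun t => r (t + 1)).
Proof.
move=> [mr [M rM]]; split.
  by apply: (measurableT_comp mr); exact: measurable_funD.
exists (2 * M) => t; apply: le_trans (_ : 2 * ((1 + `|t + 1|) * `|r (t + 1)|) <= _).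
  rewrite mulrA ler_wpM2r// mulrDr; have := ler_normB (t + 1) 1.
  by rewrite addrK normr1; have := normr_ge0 (t + 1); lra.
by rewrite ler_pM2l.
Qed.

Lemma decaying_increment r : decaying r -> decaying (fun t => r (t + 1) - r t).
Proof.
move=> dr; rewrite (_ : (fun t => _) = fun t => -1 * r t + r (t + 1)).
  exact/decaying_lin/decaying_shift.
by apply/funext => t; rewrite mulN1r addrC.
Qed.

Lemma decaying_heaviside_increment :
  decaying (fun t => heaviside (t + 1) - heaviside t).
Proof.
split.
  apply: measurable_funB; last exact: measurable_heaviside.
  by apply: (measurableT_comp measurable_heaviside); exact: measurable_funD.
exists 2 => t; rewrite /heaviside.
have [t0|t0] := leP 0 t.
  by rewrite (_ : 0 <= t + 1) ?subrr ?normr0 ?mulr0// addr_ge0.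
rewrite subr0 ltr0_norm//; have [t1|t1] := leP 0 (t + 1); rewrite ?normr1 ?normr0; lra.
Qed.

Lemma relu_heaviside t : relu t = t * heaviside t.
Proof.
by rewrite /relu /heaviside; have [t0|t0] := leP 0 t; rewrite ?mulr1 ?mulr0.
Qed.

Lemma step_like_relu_increment : step_like (fun t => relu (t + 1) - relu t).
Proof.
split.
  under eq_fun do rewrite !relu_heaviside.
  have mH := measurable_heaviside.
  apply: measurable_funB => //; apply: measurable_funB.
    apply: measurable_funM; first exact: measurable_funD.
    by apply: (measurableT_comp mH); exact: measurable_funD.
  exact: measurable_funM.
exists 2 => t; rewrite !relu_heaviside /heaviside.
have [t0|t0] := leP 0 t.
  rewrite (_ : 0 <= t + 1) ?addr_ge0// !mulr1.
  by rewrite (_ : _ - 1 = 0) ?normr0 ?mulr0//; lra.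
rewrite mulr0 !subr0 ltr0_norm//; have [t1|t1] := leP 0 (t + 1).
  by rewrite mulr1 ger0_norm//; nra.
by rewrite mulr0 normr0 mulr0.
Qed.

(** What one hidden layer with two neurons per input computes in each coordinate. *)
Definition step_combination (sigma : R -> R) (a b c : R) t :=
  a * sigma (t + 1) + b * sigma t + c.

(** The increment over a unit step turns the ramp relu into a step, the linear part
into a constant, and leaves the other terms decaying. *)
Lemma ramp_like_step (sigma r : R -> R) (alpha beta gamma delta : R) :
    beta != 0 -> decaying r ->
    (forall t, sigma t =
      alpha * t + beta * relu t + gamma + delta * heaviside t + r t) ->
  exists a b c, step_like (step_combination sigma a b c).
Proof.
move=> b0 dr sE; exists beta^-1, (- beta^-1), (- (alpha / beta)).
rewrite /step_like (_ : (fun t => _) = fun t =>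
  ((relu (t + 1) - relu t) - heaviside t) +
  ((delta / beta) * (heaviside (t + 1) - heaviside t) +
   beta^-1 * (r (t + 1) - r t))).
  apply: decayingD; first exact: step_like_relu_increment.
  apply: decayingD; apply: decayingZ; first exact: decaying_heaviside_increment.
  exact: decaying_increment.
by apply/funext => t; rewrite /step_combination !sE; field.
Qed.

(** Activations that are already steps at infinity need only be normalized. *)
Lemma jump_like_step (sigma r : R -> R) (gamma delta : R) :
    delta != 0 -> decaying r ->
    (forall t, sigma t = gamma + delta * heaviside t + r t) ->
  exists a b c, step_like (step_combination sigma a b c).
Proof.
move=> d0 dr sE; exists 0, delta^-1, (- (gamma / delta)).
rewrite /step_like (_ : (fun t => _) = fun t => delta^-1 * r t).
  exact: decayingZ.
by apply/funext => t; rewrite /step_combination !sE; field.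
Qed.

Lemma expRN_decay t : (1 + `|t|) * expR (- `|t|) <= 1.
Proof.
rewrite expRN -ler_pdivlMr ?invr_gt0 ?expR_gt0// invrK mul1r.
exact: expR_ge1Dx.
Qed.

Lemma expRN_decay2 t : (1 + `|t|) * (`|t| * expR (- `|t|)) <= 3.
Proof.
rewrite mulrA expRN -ler_pdivlMr ?invr_gt0 ?expR_gt0// invrK.
have := expR_ge1Dx `|t|; have := @expR_ge1Dxn _ `|t| 1 (normr_ge0 t).
by rewrite (_ : 2`! = 2)%N//; have := normr_ge0 t; nra.
Qed.

Lemma logistic_heaviside_le t : `|logistic t - heaviside t| <= expR (- `|t|).
Proof.
rewrite /logistic /heaviside; have [t0|t0] := leP 0 t.
  rewrite [X in _ <= expR (- X)]ger0_norm//; have e0 := expR_gt0 (- t).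
  rewrite (_ : _ - 1 = - (expR (- t) / (1 + expR (- t)))); last first.
    by field; rewrite gt_eqF// addr_gt0.
  rewrite normrN ger0_norm ?divr_ge0 ?addr_ge0 ?expR_ge0//.
  by rewrite ler_pdivrMr ?addr_gt0//; nra.
rewrite subr0 [`|t|]ltr0_norm// opprK ger0_norm ?invr_ge0 ?addr_ge0 ?expR_ge0//.
by rewrite invf_ple ?posrE ?addr_gt0 ?expR_gt0// -expRN lerDr.
Qed.

Lemma measurable_logistic : measurable_fun [set: R] (@logistic R).
Proof.
apply: nondecreasing_measurable => // s t st.
by rewrite /logistic lef_pV2 ?posrE ?addr_gt0 ?expR_gt0// lerD2l ler_expR lerN2.
Qed.

Lemma step_like_logistic : step_like (@logistic R).
Proof.
split.
  exact: measurable_funB measurable_logistic measurable_heaviside.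
exists 1 => t; apply: le_trans (expRN_decay t).
by apply: ler_wpM2l (logistic_heaviside_le t); rewrite addr_ge0.
Qed.

Lemma decaying_silu_relu : decaying (fun t => silu t - relu t).
Proof.
under eq_fun do rewrite relu_heaviside /silu -mulrBr.
split.
  apply: measurable_funM => //.
  exact: measurable_funB measurable_logistic measurable_heaviside.
exists 3 => t; apply: le_trans (expRN_decay2 t).
rewrite normrM; apply: ler_wpM2l; first by rewrite addr_ge0.
exact: ler_wpM2l (logistic_heaviside_le t).
Qed.

Lemma tanh_logistic t : tanh t = 2 * logistic (2 * t) - 1.
Proof.
have e0 := expR_gt0 t; have n0 : expR t != 0 by rewrite gt_eqF.
have p0 : expR t ^+ 2 + 1 != 0 by rewrite gt_eqF// addr_gt0// exprn_gt0.
rewrite /tanh /logistic !expRN (_ : 2 * t = t + t); last by ring.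
by rewrite expRD; field; rewrite n0 p0.
Qed.

Lemma decaying_tanh : decaying (fun t => tanh t - (2 * heaviside t - 1)).
Proof.
have [mL [M LM]] := step_like_logistic.
have -> : (fun t => tanh t - (2 * heaviside t - 1)) =
    fun t => 2 * (logistic (2 * t) - heaviside (2 * t)).
  apply/funext => t; rewrite tanh_logistic (_ : heaviside (2 * t) = heaviside t).
    by ring.
  by rewrite /heaviside pmulr_rge0.
apply: decayingZ; split.
  by apply: (measurableT_comp mL); exact: measurable_funM.
exists M => t; apply: le_trans (LM (2 * t)); apply: ler_wpM2r => //.
by rewrite normrM ger0_norm//; have := normr_ge0 t; lra.
Qed.

Lemma softplus_relu_le t : `|softplus t - relu t| <= expR (- `|t|).
Proof.
have ln1D_le s : `|ln (1 + expR s)| <= expR s.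
  rewrite ger0_norm ?ln_ge0 ?lerDl ?expR_ge0// le_ln1Dx//.
  by rewrite (lt_trans _ (expR_gt0 s)).
rewrite /softplus relu_heaviside /heaviside; have [t0|t0] := leP 0 t.
  rewrite [`|t|]ger0_norm// (_ : ln _ - _ = ln (1 + expR (- t)))//.
  have -> : 1 + expR t = expR t * (1 + expR (- t)).
    by rewrite mulrDr mulr1 -expRD subrr expR0 addrC.
  by rewrite lnM ?posrE ?expR_gt0 ?addr_gt0 ?expR_gt0// expRK mulr1 addrC addKr.
by rewrite mulr0 subr0 [`|t|]ltr0_norm// opprK.
Qed.

Lemma decaying_softplus_relu : decaying (fun t => softplus t - relu t).
Proof.
split.
  apply: measurable_funB.
    apply: (measurableT_comp (@measurable_ln R)).
    by apply: measurable_funD => //; exact: measurable_expR.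
  rewrite (funext relu_heaviside).
  by apply: measurable_funM => //; exact: measurable_heaviside.
exists 1 => t; apply: le_trans (expRN_decay t).
by apply: ler_wpM2l (softplus_relu_le t); rewrite addr_ge0.
Qed.

Lemma decaying_exp_left : decaying (fun t => expR t * (1 - heaviside t)).
Proof.
split.
  apply: measurable_funM; first exact: measurable_expR.
  by apply: measurable_funB => //; exact: measurable_heaviside.
exists 1 => t; apply: le_trans (expRN_decay t).
apply: ler_wpM2l; first by rewrite addr_ge0.
rewrite /heaviside; have [t0|t0] := leP 0 t.
  by rewrite subrr mulr0 normr0 expR_ge0.
by rewrite subr0 mulr1 [`|t|]ltr0_norm// opprK ger0_norm ?expR_ge0.
Qed.

(** A Chebyshev bound in which t^2 is absorbed by the density: t^2 <= x^2 on A, and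
x^2 times the density of variance 1 is at most a multiple of the density of
variance 4, whose total mass is 1. *)
Lemma normal_prob_tail (A : set R) t : measurable A ->
  (forall x, A x -> t ^+ 2 <= x ^+ 2) ->
  t ^+ 2 * fine (normal_prob 0 1 A) <= 3 * (normal_peak 1 / normal_peak 2).
Proof.
move=> mA tA; set c := 3 * _.
have pdf_le x : x ^+ 2 * normal_pdf 0 1 x <= c * normal_pdf 0 2 x.
  have p1 := normal_peak_gt0 (oner_neq0 R).
  have p2 : 0 < normal_peak (2 : R) by rewrite normal_peak_gt0// pnatr_eq0.
  rewrite !normal_pdfE ?oner_neq0 ?pnatr_eq0// /normal_fun !subr0.
  (* x^2 <= 3 exp (3 x^2 / 8), the exponent being the gap 1/2 - 1/8. *)
  have -> : - x ^+ 2 / (1 ^+ 2 *+ 2) =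
      - x ^+ 2 / (2 ^+ 2 *+ 2) - 3 / 8 * x ^+ 2 :> R by field.
  rewrite expRD expRN /c; set e1 := expR _; set e2 := expR _.
  have e1_gt0 : 0 < e1 by exact: expR_gt0.
  have e2_gt0 : 0 < e2 by exact: expR_gt0.
  have e2x : x ^+ 2 <= 3 * e2.
    by have := expR_ge1Dx (3 / 8 * x ^+ 2); rewrite -/e2; lra.
  have -> : 3 * (normal_peak 1 / normal_peak 2) * (normal_peak 2 * e1) =
      normal_peak 1 * e1 * 3 by field; rewrite gt_eqF.
  have -> : x ^+ 2 * (normal_peak 1 * (e1 / e2)) =
      normal_peak 1 * e1 * (x ^+ 2 / e2) by ring.
  by rewrite ler_pM2l ?mulr_gt0// ler_pdivrMr.
have c0 : 0 <= c by rewrite mulr_ge0// divr_ge0// normal_peak_ge0.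
have pA1 : normal_prob 0 1 A \is a fin_num by exact: fin_num_measure.
rewrite -lee_fin EFinM fineK//.
apply: (@le_trans _ _ (c%:E * normal_prob 0 2 A)%E); last first.
  rewrite -[leRHS]mule1; apply: lee_wpmul2l; first by rewrite lee_fin.
  exact: (@probability_le1 _ _ _ (normal_prob 0 2)).

have mpdf s : measurable_fun A (fun x => (normal_pdf 0 s x)%:E).
  by apply/measurable_EFinP/measurable_funTS; exact: measurable_normal_pdf.
have pdf0 s x : A x -> (0 <= (normal_pdf 0 s x)%:E)%E.
  by move=> _; rewrite lee_fin normal_pdf_ge0.
rewrite /normal_prob -!ge0_integralZl ?lee_fin ?sqr_ge0//;
  [|exact: mpdf|exact: pdf0|exact: mpdf|exact: pdf0].
apply: ge0_le_integral => //.
- by move=> x Ax; rewrite mule_ge0 ?pdf0// lee_fin sqr_ge0.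
- by apply: measurable_funeM; exact: mpdf.
- by apply: measurable_funeM; exact: mpdf.
- move=> x Ax; rewrite -!EFinM lee_fin (le_trans _ (pdf_le x))//.
  by rewrite ler_wpM2r ?normal_pdf_ge0// tA.
Qed.

(** gelu t - relu t = t (Phi t - heaviside t), and |Phi t - heaviside t| is the
normal probability of the half-line beyond t, which is O (1 / t^2). *)
Lemma decaying_gelu_relu : decaying (fun t => gelu t - relu t).
Proof.
pose P : set R -> \bar R := normal_prob 0 1.
pose Phi t := fine (P `]-oo, t]%classic).
have Pfin (A : set R) : measurable A -> P A \is a fin_num.
  by move=> mA; exact: fin_num_measure.
have mPhi : measurable_fun [set: R] Phi.
  apply: nondecreasing_measurable => // s t st; rewrite fine_le ?Pfin//.
  by rewrite le_measure ?inE//; apply: subset_itvl; rewrite bnd_simp.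
rewrite (_ : (fun t => _) = fun t => t * (Phi t - heaviside t)); last first.
  by apply/funext => t; rewrite relu_heaviside mulrBr.
split.
  by apply: measurable_funM => //; exact: measurable_funB mPhi measurable_heaviside.
set c := 3 * (@normal_peak R 1 / normal_peak 2).
have tailE t : exists2 A : set R, measurable A &
    (forall x, A x -> t ^+ 2 <= x ^+ 2) /\ `|Phi t - heaviside t| = fine (P A).
  rewrite /heaviside; have [t0|t0] := leP 0 t.
    exists `]t, +oo[%classic => //; split.
      move=> x /=; rewrite in_itv/= andbT => tx.
      by rewrite lerXn2r ?nnegrE ?(ltW tx)// (le_trans t0) ?ltW.
    have -> : `]t, +oo[%classic = ~` `]-oo, t]%classic :> set R by rewrite setCitvl.
    rewrite /P probability_setC//= fineB ?Pfin// distrC ger0_norm//.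
    rewrite subr_ge0 -lee_fin fineK ?Pfin//.
    exact: (@probability_le1 _ _ _ (normal_prob 0 1)).
  exists `]-oo, t]%classic => //; split.
    move=> x /=; rewrite in_itv/= => xt.
    rewrite -sqrrN -[leRHS]sqrrN lerXn2r ?nnegrE ?oppr_ge0 ?lerN2//.
      exact: ltW.
    by rewrite (le_trans xt)// ltW.
  by rewrite subr0 ger0_norm// fine_ge0.
exists (1 + 2 * c) => t; have [A mA [tA DE]] := tailE t.
have := normal_prob_tail mA tA; rewrite -/c => tP.
have P1 : fine (P A) <= 1.
  by rewrite -lee_fin fineK ?Pfin//; exact: (@probability_le1 _ _ _ (normal_prob 0 1)).
have P0 : 0 <= fine (P A) by rewrite fine_ge0.
rewrite normrM DE; rewrite -(real_normK (num_real t)) in tP.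
move: (fine _) P0 P1 tP => p p0 p1 tp.
have t2 : `|t| <= 1 + `|t| ^+ 2 by nra.
have := ler_wpM2r p0 t2; nra.
Qed.

(** Up to decaying terms, the activations are combinations of a linear function, a
ramp, a constant and a step. *)
Lemma usual_activation_step (sigma : R -> R) : usual_activation sigma ->
  exists a b c, step_like (step_combination sigma a b c).
Proof.
case.
- apply: (ramp_like_step (alpha := 0) (gamma := 0) (delta := 0) (oner_neq0 R)
    decaying0) => t; by rewrite /=; ring.
- move=> a /andP[a0 a1].
  apply: (ramp_like_step (r := cst 0) (alpha := a) (beta := 1 - a) (gamma := 0)
    (delta := 0) _ decaying0) => [|t]; first by rewrite subr_eq0 gt_eqF.
  rewrite relu_heaviside /leaky_relu /heaviside.
  by have [t0|t0] := leP 0 t; rewrite /=; ring.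
- move=> a a0.
  apply: (ramp_like_step (alpha := 0) (gamma := - a) (delta := a) (oner_neq0 R)
    (decayingZ a decaying_exp_left)) => t.
  rewrite relu_heaviside /elu /heaviside.
  by have [t0|t0] := leP 0 t; rewrite /=; ring.
- apply: (jump_like_step (gamma := 0) (oner_neq0 R) step_like_logistic) => t.
  by ring.
- apply: (jump_like_step (gamma := -1) (delta := 2) _ decaying_tanh) => [|t].
    by rewrite pnatr_eq0.
  by ring.
- apply: (ramp_like_step (alpha := 0) (gamma := 0) (delta := 0) (oner_neq0 R)
    decaying_softplus_relu) => t; by ring.
- apply: (ramp_like_step (alpha := 0) (gamma := 0) (delta := 0) (oner_neq0 R)
    decaying_silu_relu) => t; by ring.
- apply: (ramp_like_step (alpha := 0) (gamma := 0) (delta := 0) (oner_neq0 R)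
    decaying_gelu_relu) => t; by ring.
Qed.

End activations_are_step_like.

(** * Networks approximating orthants *)

Section orthant_network.
Context {R : realType}.
Implicit Types (h : R -> R) (u : nat -> R).

Lemma step_like_bounded h : step_like h -> exists M, forall t, `|h t| <= M.
Proof.
move=> [_ [M hM]]; exists (M + 1) => t.
rewrite -(subrK (heaviside t) (h t)) (le_trans (ler_normD _ _))//.
apply: lerD; last by rewrite /heaviside ger0_norm ?ler0n// lern1 leq_b1.
apply: le_trans (hM t).
by rewrite ler_peMl// lerDl.
Qed.

Lemma measurable_step_like h : step_like h -> measurable_fun [set: R] h.
Proof.
move=> [mh _]; rewrite (_ : h = fun t => (h t - heaviside t) + heaviside t).
  by apply: measurable_funD => //; exact: measurable_heaviside.
by apply/funext => t; rewrite subrK.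
Qed.

(** Along a sequence that leaves every bounded set linearly, h takes in the limit
the value of the step on the side selected by b. *)
Lemma step_like_cvg h u (c : R) (b : bool) : step_like h -> 0 < c ->
    (\forall n \near \oo, c * n%:R <= (-1) ^+ (~~ b) * u n) ->
  h (u n) @[n --> \oo] --> (b%:R : R).
Proof.
move=> [_ [M hM]] c0 cu.
have sgnE t : 0 < (-1) ^+ (~~ b) * t -> heaviside t = b%:R.
  rewrite /heaviside; case: b {cu} => /=; first by rewrite mul1r => /ltW ->.
  by rewrite expr1 mulN1r oppr_gt0 ltNge => /negPf ->.
apply/cvgrPdist_lt => e e0.
have [k _ kM] : \forall n \near \oo, M / (e * c) <= n%:R :> R by exact: nbhs_infty_ger.
near=> n.
have n0 : (0 < n)%N by near: n; exact: nbhs_infty_gt.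
have cun : c * n%:R <= (-1) ^+ (~~ b) * u n by near: n.
have Mn : M <= n%:R * (e * c).
  by rewrite -ler_pdivrMr ?mulr_gt0//; apply: kM; near: n; exists k.
have cn0 : 0 < c * n%:R by rewrite mulr_gt0// ltr0n.
have -> : b%:R = heaviside (u n) :> R by rewrite sgnE ?(lt_le_trans cn0).
have cu' : c * n%:R <= `|u n|.
  rewrite (le_trans cun)// (le_trans (ler_norm _))//.
  by rewrite normrM normrX normrN1 expr1n mul1r.
rewrite distrC -(ltr_pM2l (x := 1 + `|u n|)) ?ltr_wpDr//.
apply: le_lt_trans (hM (u n)) _; apply: le_lt_trans Mn _; nra.
Unshelve. all: by end_near. Qed.

Lemma cvg_sum_ord (d : nat) (f : nat -> 'I_d -> R) (l : 'I_d -> R) :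
    (forall i, f n i @[n --> \oo] --> l i) ->
  \sum_(i < d) f n i @[n --> \oo] --> \sum_(i < d) l i.
Proof.
elim: d f l => [|d ih] f l fl.
  by under eq_fun do rewrite big_ord0; rewrite big_ord0; exact: cvg_cst.
under eq_fun do rewrite big_ord_recl.
by rewrite big_ord_recl; apply: cvgD; [exact: fl|exact: ih].
Qed.

Definition orthant (d : nat) (a : 'rV[R]_d) : set 'rV[R]_d :=
  [set x | forall i, a ord0 i < x ord0 i].

(** The inner slope n^2 dominates the shift n when a_i < x_i, while the shift
sends the case x_i = a_i to the inactive side.  The sum then tends to the number of
satisfied inequalities, and the threshold d - 1/2 separates d from the smaller
integers. *)
Definition orthant_network h (d : nat) (a : 'rV[R]_d) (n : nat) (x : 'rV[R]_d) : R :=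
  h (n%:R * (\sum_i h (n%:R ^+ 2 * (x ord0 i - a ord0 i) - n%:R) - d%:R + 2^-1)).

Lemma orthant_network_cvg h d (a x : 'rV[R]_d) : step_like h ->
  orthant_network h a n x @[n --> \oo] --> (\1_(orthant a) x : R).
Proof.
move=> sh.
have inner i : h (n%:R ^+ 2 * (x ord0 i - a ord0 i) - n%:R) @[n --> \oo] -->
    ((a ord0 i < x ord0 i)%R%:R : R).
  apply: (step_like_cvg sh ltr01); have [axi|xai] := ltP (a ord0 i) (x ord0 i).
    set D := x ord0 i - a ord0 i; have D0 : 0 < D by rewrite subr_gt0.
    near=> n; rewrite expr0 !mul1r.
    have : 2 / D <= n%:R by near: n; exact: nbhs_infty_ger.
    rewrite ler_pdivrMr// => nD; have := ler0n R n; nra.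
  near=> n; rewrite expr1 mulN1r mul1r; have := ler0n R n.
  set D := x ord0 i - a ord0 i; have D0 : D <= 0 by rewrite subr_le0.
  by have := sqr_ge0 (n%:R : R); nra.
have := cvg_sum_ord inner; set l := \sum_i _ => suml.
rewrite indicE; apply: (step_like_cvg (c := 4^-1) sh); first by rewrite invr_gt0.
have [/set_mem ax|/negP nax] := boolP (x \in orthant a).
  have ld : l = d%:R.
    by rewrite /l (eq_bigr (fun=> 1)) ?sumr_const ?card_ord// => i _; rewrite ax.
  near=> n; rewrite expr0 mul1r mulrC ler_wpM2l//.
  have : d%:R - 4^-1 < \sum_i h (n%:R ^+ 2 * (x ord0 i - a ord0 i) - n%:R).
    near: n; apply: (cvgr_gt _ suml); rewrite ld; lra.
  by lra.
have ld : l + 1 <= d%:R.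
  have [i /negP xai] : exists i, ~ (a ord0 i < x ord0 i).
    by apply/existsNP => ax; apply: nax; rewrite inE.
  rewrite /l (bigD1 i)//= (negPf xai) add0r -[X in _ <= X](_ : \sum_(j < d) 1 = _).
    rewrite [leRHS](bigD1 i)//= [leLHS]addrC lerD2l; apply: ler_sum => j _.
    by rewrite lern1 leq_b1.
  by rewrite sumr_const card_ord.
near=> n; rewrite expr1 mulN1r mulrC -mulrN ler_wpM2l//.
have : \sum_i h (n%:R ^+ 2 * (x ord0 i - a ord0 i) - n%:R) < d%:R - 3 / 4.
  near: n; apply: (cvgr_lt _ suml); lra.
by lra.
Unshelve. all: by end_near. Qed.

Lemma orthant_network_bounded h d (a : 'rV[R]_d) : step_like h ->
  exists M, forall n x, `|orthant_network h a n x| <= M.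
Proof. by move=> /step_like_bounded[M hM]; exists M => n x; exact: hM. Qed.

Lemma measurable_orthant_network dT (T : measurableType dT) h d (a : 'rV[R]_d)
    (n : nat) (X : T -> 'rV[R]_d) : step_like h ->
    (forall i, measurable_fun [set: T] (fun t => X t ord0 i)) ->
  measurable_fun [set: T] (fun t => orthant_network h a n (X t)).
Proof.
move=> /measurable_step_like mh mX; apply: (measurableT_comp mh).
apply: measurable_funM => //; do 2 apply: measurable_funD => //.
apply: measurable_sum => i; apply: (measurableT_comp mh).
by apply: measurable_funD => //; apply: measurable_funM => //; exact: measurable_funB.
Qed.

Section feedforward.
Variables (sigma : R -> R) (a b c : R).
Local Notation h := (step_combination sigma a b c).

(** The first affine map duplicates the input as (x + 1, x), the second one
recombines the two halves of the hidden layer. *)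
Lemma feedforward_step_combination m :
  feedforward sigma (fun x : 'rV[R]_m => map_mx h x).
Proof.
pose A := row_mx 1%:M 1%:M : 'M[R]_(m, m + m).
pose v := row_mx (const_mx 1) 0 : 'rV[R]_(m + m).
pose B := col_mx a%:M b%:M : 'M[R]_(m + m, m).
rewrite (_ : (fun x => _) =
    fun x : 'rV[R]_m => map_mx sigma (x *m A + v) *m B + const_mx c).
  apply: (ff_comp (g := fun y : 'rV[R]_(m + m) => y *m B + const_mx c)).
    apply: (ff_comp (f := fun x : 'rV[R]_m => x *m A + v)
      (g := fun y : 'rV[R]_(m + m) => map_mx sigma y)).
      exact: ff_affine.
    exact: ff_activation.
  exact: ff_affine.
apply/funext => x; rewrite mul_mx_row mulmx1 add_row_mx addr0 map_row_mx.
rewrite mul_row_col !mul_mx_scalar; apply/rowP => j.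
by rewrite !mxE.
Qed.

Lemma scalar_network_orthant d (v : 'rV[R]_d) n :
  scalar_network sigma (orthant_network h v n).
Proof.
pose N2 : R := n%:R ^+ 2.
exists (fun x : 'rV[R]_d => map_mx h
  (map_mx h (x *m N2%:M + (const_mx (- n%:R) - N2 *: v)) *m const_mx n%:R +
   const_mx (n%:R * (2^-1 - d%:R)))).
  apply: (ff_comp (g := fun y : 'rV[R]_1 => map_mx h y)); last first.
    exact: feedforward_step_combination.
  apply: (ff_comp (g := fun y : 'rV[R]_d => y *m const_mx n%:R +
    const_mx (n%:R * (2^-1 - d%:R)))); last exact: ff_affine.
  apply: (ff_comp (g := fun y : 'rV[R]_d => map_mx h y)); first exact: ff_affine.
  exact: feedforward_step_combination.
move=> x; rewrite !mxE /orthant_network; congr h.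
rewrite -[in LHS]addrA mulrDr mulr_sumr [- d%:R + _]addrC; congr (_ + _).
apply: eq_bigr => i _; rewrite mul_mx_scalar !mxE mulrC; congr (h _ * _).
by rewrite /N2; ring.
Qed.

Lemma scalar_network_cst d (s : R) : scalar_network sigma (fun _ : 'rV[R]_d => s).
Proof.
exists (fun x => x *m 0 + const_mx s); first exact: ff_affine.
by move=> x; rewrite mulmx0 add0r mxE.
Qed.

End feedforward.
End orthant_network.

(** * Orthants generate the Borel sets *)

Section borel_orthants.
Context {R : realType} {d : nat} (X : set 'rV[R]_d) (X0 : X !=set0).
Local Notation T := (borelType X0).
Local Notation val := (@borelType_val _ X X0).

Lemma borelType_open (U : set 'rV[R]_d) : open U ->
  @open (nonempty_subtype X0) (val @^-1` U).
Proof. by move=> oU; exists U. Qed.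

Lemma measurable_borelType_coord i :
  measurable_fun [set: T] (fun t => val t ord0 i).
Proof.
apply: (measurability _ (RGenOInfty.measurableE R)) => _ [_ [x ->] <-].
rewrite setTI; apply: sub_sigma_algebra.
have -> : (fun t : T => val t ord0 i) @^-1` `]x, +oo[%classic =
    val @^-1` ((fun y : 'rV[R]_d => y ord0 i) @^-1` `]x, +oo[%classic) by [].
apply: borelType_open; apply: open_comp; last exact: interval_open.
by move=> y _; exact: coord_continuous.
Qed.

Definition orthants : set (set T) := [set val @^-1` orthant a | a in setT].

Lemma measurable_orthant a : measurable (val @^-1` orthant a : set T).
Proof.
have -> : val @^-1` orthant a = ~` \bigcup_(i : 'I_d)
    ((fun t => val t ord0 i) @^-1` `]-oo, a ord0 i]%classic) :> set T.
  apply/seteqP; split => t.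
    by move=> ta [i _ /=]; rewrite in_itv/= leNgt ta.
  move=> nta i; rewrite ltNge; apply/negP => tai; apply: nta.
  by exists i => //=; rewrite in_itv.
apply: measurableC; apply: countable_bigcupT_measurable => [|i].
  exact: countableP.
by rewrite -[X in measurable X]setTI; exact: measurable_borelType_coord.
Qed.

Lemma orthantI (a b : 'rV[R]_d) :
  orthant a `&` orthant b = orthant (\row_i Num.max (a ord0 i) (b ord0 i)).
Proof.
apply/seteqP; split => x.
  by move=> [ax bx] i; rewrite mxE gt_max ax bx.
by move=> abx; split => i; have := abx i; rewrite mxE gt_max => /andP[].
Qed.

Lemma setI_closed_orthants : setI_closed orthants.
Proof.
move=> _ _ [a _ <-] [b _ <-]; rewrite -preimage_setI orthantI.
by eexists.
Qed.

Definition box (q r : 'rV[R]_d) : set 'rV[R]_d :=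
  [set x | forall i, q ord0 i < x ord0 i <= r ord0 i].

(** Subtracting, for each i, the points of the orthant of q that violate
x_i <= r_i. *)
Lemma box_orthants q r : box q r = orthant q `\` \bigcup_(i : 'I_d)
  orthant (\row_j (if j == i then Num.max (q ord0 j) (r ord0 j) else q ord0 j)).
Proof.
apply/seteqP; split => x.
  move=> qxr; split => [i|[i _ /(_ i)]]; first by have /andP[] := qxr i.
  rewrite mxE eqxx gt_max ltNge => /andP[_].
  by rewrite ltNge; have /andP[_ ->] := qxr i.
move=> [qx nrx] i; rewrite qx /= leNgt; apply/negP => rx; apply: nrx.
exists i => // j; rewrite mxE; case: eqP => [->|_]; last exact: qx.
by rewrite gt_max qx.
Qed.

(** The boxes with rational corners are countably many; those not contained in U
are replaced by the empty set to keep the index type countable. *)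
Lemma open_box_cover (U : set 'rV[R]_d) : open U ->
  U = \bigcup_(p : 'rV[rat]_d * 'rV[rat]_d)
    (let B := box (map_mx ratr p.1) (map_mx ratr p.2) in
     if `[< B `<=` U >] then B else set0).
Proof.
move=> oU; apply/seteqP; split => [x Ux|x [p _]]; last first.
  by rewrite /=; case: asboolP => // BU /BU.
have /nbhs_ballP[e /= e0 eU] : nbhs x U by exact: open_nbhs_nbhs.
have exq i : exists q : rat, x ord0 i - e < ratr q < x ord0 i.
  have : x ord0 i - e < x ord0 i by rewrite ltrBlDr ltrDl.
  by move=> /rat_in_itvoo[q]; rewrite in_itv /=; exists q.
have exr i : exists r : rat, x ord0 i < ratr r < x ord0 i + e.
  have : x ord0 i < x ord0 i + e by rewrite ltrDl.
  by move=> /rat_in_itvoo[r]; rewrite in_itv /=; exists r.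
have [q qP] := choice exq; have [r rP] := choice exr.
exists (\row_i q i, \row_i r i) => //=.
have -> : `[< box (map_mx ratr (\row_i q i)) (map_mx ratr (\row_i r i)) `<=` U >].
  apply/asboolP => y By; apply: eU; split => // i j; rewrite !ord1.
  have := By j; have := qP j; have := rP j; rewrite !mxE /ball/=.
  by rewrite ltr_norml => /andP[? ?] /andP[? ?] /andP[? ?]; lra.
by move=> i; rewrite !mxE; have := qP i; have := rP i; lra.
Qed.

Lemma measurable_orthants : measurable `<=` <<s orthants >>.
Proof.
pose S := g_sigma_algebraType orthants.
apply: smallest_sub; first exact: smallest_sigma_algebra.
move=> _ [U oU <-]; rewrite (open_box_cover oU) preimage_bigcup.
suff : measurable (\bigcup_(p : 'rV[rat]_d * 'rV[rat]_d)
    (val @^-1` (let B := box (map_mx ratr p.1) (map_mx ratr p.2) in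
     if `[< B `<=` U >] then B else set0)) : set S) by [].
have mO a : measurable (val @^-1` orthant a : set S).
  by apply: sub_sigma_algebra; exists a.
apply: countable_bigcupT_measurable => [|p /=].
  exact: countableP.
case: ifPn => _; last by rewrite preimage_set0.
rewrite box_orthants; apply: (measurableD (mO _)).
exact: (countable_bigcupT_measurable (countableP _) (fun i => mO _)).
Qed.

End borel_orthants.

(** * Finite-rank approximation from a dense dictionary *)

Section span_approximation.
Context d (T : measurableType d) (R : realType).
Variable nu : {measure set T -> \bar R}.
Local Notation L2 := (LspaceType2 nu).
Implicit Types (W : set L2) (t : seq (R * L2)) (F G : L2).

Definition combination t : L2 := \sum_(p <- t) p.1 *: p.2.

Definition in_dictionary W t := forall p, p \in t -> W p.2.

Definition approximable W F := forall e : R, 0 < e ->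
  exists2 t, in_dictionary W t & `|combination t - F| < e.

Lemma approximable_dictionary W F : W F -> approximable W F.
Proof.
move=> WF e e0; exists [:: (1, F)]; first by move=> p /[!inE] /eqP ->.
by rewrite /combination big_seq1 scale1r subrr normr0.
Qed.

Lemma approximable_lin W a F G :
  approximable W F -> approximable W G -> approximable W (a *: F + G).
Proof.
move=> aF aG e e0; have a0 : 0 < `|a| + 1 by rewrite ltr_wpDl.
have [|t Wt tF] := aF (e / (2 * (`|a| + 1))); first by rewrite divr_gt0 ?mulr_gt0.
have [|t' Wt' tG] := aG (e / 2); first by rewrite divr_gt0.
exists ([seq (a * p.1, p.2) | p <- t] ++ t').
  by move=> p; rewrite mem_cat => /orP[/mapP[q qt ->]|/Wt'//]; exact: Wt qt.
have -> : combination ([seq (a * p.1, p.2) | p <- t] ++ t') =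
    a *: combination t + combination t'.
  rewrite /combination big_cat big_map scaler_sumr; congr (_ + _).
  by apply: eq_bigr => p _; rewrite scalerA.
rewrite opprD addrACA -scalerBr (le_lt_trans (ler_normD _ _))//.
rewrite [ltRHS]splitr ltr_leD ?(ltW tG)// normrZ.
apply: (@le_lt_trans _ _ ((`|a| + 1) * `|combination t - F|)).
  by rewrite ler_wpM2r// lerDl.
by rewrite -ltr_pdivlMl// mulrC -mulrA -invfM.
Qed.

Lemma approximable_closed W F :
    (forall e : R, 0 < e -> exists2 G, approximable W G & `|G - F| < e) ->
  approximable W F.
Proof.
move=> aF e e0; have e20 : 0 < e / 2 by rewrite divr_gt0.
have [G /(_ _ e20)[t Wt tG] GF] := aF _ e20; exists t => //.
rewrite -(subrKA G) (le_lt_trans (ler_normD _ _))// [ltRHS]splitr.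
exact: ltrD.
Qed.

Lemma gram_projection_combination N (phi : 'I_N -> L2) t :
    (forall p, p \in t -> exists j, p.2 = phi j) ->
  gram_projection phi (combination t) = combination t.
Proof.
move=> tphi; rewrite /combination linear_sum /= !big_seq; apply: eq_bigr => p.
by move=> /tphi[j ->]; rewrite linearZ /= gram_projection_basis.
Qed.

Section compression.
Variables (N : nat) (phi : 'I_N -> L2) (L : {linear L2 -> L2}).

(** With Q the generalized inverse of the Gram matrix used by the projection P,
R_phi (Q P_phi g) is P g, so that wrapping this map between P_phi and R_phi gives
P L P. *)
Definition compression (a : 'cV[R]_N) : 'cV[R]_N :=
  pinvmx (gram phi) *m
    coefficients phi (L (reconstruction phi (pinvmx (gram phi) *m a))).

Lemma compression_is_linear : linear compression.
Proof.
by move=> c a b; rewrite /compression !(mulmxDr, =^~ scalemxAr, linearD, linearZ).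
Qed.

HB.instance Definition _ :=
  GRing.isLinear.Build R 'cV[R]_N 'cV[R]_N _ compression compression_is_linear.

Lemma compressionE F :
  (reconstruction phi \o compression \o coefficients phi) F =
  gram_projection phi (L (gram_projection phi F)).
Proof. by []. Qed.

End compression.

Lemma compact_finite_net (K : set L2) (e : R) : compact K -> 0 < e ->
  exists s : seq L2, forall F, K F -> exists2 G, G \in s & `|G - F| < e.
Proof.
rewrite compact_cover => cK e0.
have [| |D _ KD] := cK L2 K (fun G => ball G e).
- by move=> G _; exact: ball_open.
- by move=> F KF; exists F => //; exact: ballxx.
exists (finmap.enum_fset D) => F /KD[G DG GF].
by exists G => //; move: GF; rewrite -ball_normE.
Qed.

Lemma continuous_linear_bound (L : {linear L2 -> L2}) : continuous L ->
  exists2 C : R, 0 < C & forall F, `|L F| <= C * `|F|.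
Proof.
move=> /linear_bounded_continuous/linear_boundedP LB.
near (+oo_R) => C; exists C; first by near: C; exact: nbhs_pinfty_gt.
near: C; exact: LB.
Unshelve. all: by end_near. Qed.

(** A dictionary with dense span contains, for every e, a finite family whose span
comes within e of a finite net of K and of the images of the net.  The choice
e = eps / (6 C + 2) comes from the two error terms 2 (C + 1) e and C (4 e). *)
Lemma compact_compression W (W0 : W !=set0) (L : {linear L2 -> L2})
    (K : set L2) (eps : R) :
    (forall F, approximable W F) -> continuous L -> compact K -> 0 < eps ->
  exists N (phi : 'I_N -> L2), [/\ (0 < N)%N, forall j, W (phi j) &
    forall F, K F -> `|L F -
      (reconstruction phi \o compression phi L \o coefficients phi) F| <= eps].
Proof.
move=> dW cL cK eps0; have [F0 WF0] := W0.
have [C C0 LC] := continuous_linear_bound cL.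
have D0 : 0 < 6 * C + 2 by rewrite addr_gt0 ?mulr_gt0.
have [e e0 eE] : exists2 e : R, 0 < e & e * (6 * C + 2) = eps.
  by exists (eps / (6 * C + 2)); rewrite ?divfK ?divr_gt0 ?gt_eqF.
have [net netK] := compact_finite_net cK e0.
have /choice[t tP] F : exists t, in_dictionary W t /\ `|combination t - F| < e.
  by have [t] := dW F e e0; exists t.
(* F0 keeps the family nonempty when the net is empty. *)
pose s := F0 :: flatten [seq [seq p.2 | p <- t F ++ t (L F)] | F <- net].
have Ws F : F \in s -> W F.
  rewrite inE => /predU1P[->//|/flattenP[/= _ /mapP[G _ ->]] /mapP[p]].
  by rewrite mem_cat => /orP[|] pt ->; [apply: (tP G).1|apply: (tP (L G)).1].
pose phi (j : 'I_(size s)) := tnth (in_tuple s) j.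
pose P := gram_projection phi.
have Pfix F : (exists2 G, G \in net & F = G \/ F = L G) ->
    P (combination (t F)) = combination (t F).
  move=> [G Gnet FG]; apply: gram_projection_combination => p pt.
  suff /(tnthP (in_tuple s))[j pj] : p.2 \in s by exists j.
  rewrite inE; apply/orP; right; apply/flattenP.
  exists [seq p.2 | p <- t G ++ t (L G)]; first exact: map_f.
  by apply: map_f; rewrite mem_cat; case: FG => <-; rewrite pt ?orbT.
exists (size s), phi; split => // [j|F KF].
  by apply: Ws; exact: mem_tnth.
rewrite compressionE -/P.
have [G Gnet GF] := netK F KF.
have PF : `|F - P F| <= 4 * e.
  apply: (le_trans (gram_projection_dist _ (Pfix G _))).
    by exists G => //; left.
  rewrite (_ : 4 * e = 2 * (e + e)); last by ring.
  apply: ler_wpM2l => //; apply: (le_trans (ler_distD G _ _)); rewrite distrC.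
  by apply: lerD; apply: ltW => //; rewrite distrC; exact: (tP G).2.
have PLF : `|L F - P (L F)| <= 2 * ((C + 1) * e).
  apply: (le_trans (gram_projection_dist _ (Pfix (L G) _))).
    by exists G => //; right.
  apply: ler_wpM2l => //; apply: (le_trans (ler_distD (L G) _ _)).
  rewrite mulrDl mul1r; apply: lerD; last first.
    by apply: ltW; rewrite distrC; exact: (tP (L G)).2.
  rewrite -linearB; apply: (le_trans (LC _)); apply: ler_wpM2l; first exact: ltW.
  by rewrite distrC; exact: ltW.
have PLPF : `|P (L F) - P (L (P F))| <= C * (4 * e).
  rewrite -!linearB; apply: le_trans (gram_projection_le _ _) _.
  by apply: le_trans (LC _) _; apply: ler_wpM2l => //; exact: ltW.
apply: (le_trans (ler_distD (P (L F)) _ _)).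
rewrite -eE (_ : e * _ = 2 * ((C + 1) * e) + C * (4 * e)); last by ring.
exact: lerD.
Qed.

End span_approximation.

(** * Density of the networks *)

Section neural_density.
Context {R : realType} {d : nat} (X : set 'rV[R]_d) (X0 : X !=set0).
Variables (nu : probability (borelType X0) R) (sigma : R -> R).
Local Notation L2 := (LspaceType2 nu).
Local Notation val := (@borelType_val _ X X0).

Definition network_class : set L2 := [set F | exists2 f : 'rV[R]_d -> R,
  scalar_network sigma f & (F : borelType X0 -> R) = f \o val %[ae nu]].

Lemma represented_network (f : 'rV[R]_d -> R) (M : R) : scalar_network sigma f ->
    measurable_fun [set: borelType X0] (f \o val) ->
    (forall x, `|f x| <= M) ->
  represented (nu := nu) (approximable network_class) (f \o val).
Proof.
move=> nf mf fM; have f2 : f \o val \in Lfun nu 2%:E.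
  exact: (@Lfun2_bounded _ _ _ nu _ _ mf (fun x => fM (val x))).
exists (Lclass (lee1n 2) f2); last exact: LclassE.
apply: approximable_dictionary; exists f => //; exact: LclassE.
Qed.

(** The networks approximating an orthant are bounded by one constant, which is
square integrable for a probability measure. *)
Lemma neural_density : usual_activation sigma ->
  forall F : L2, approximable network_class F.
Proof.
move=> /usual_activation_step[a [b [c sh]]].
have closedW := @approximable_closed _ _ _ nu network_class.
apply: (@closed_subspace_full _ _ _ nu _ _ closedW _ (@orthants R d X X0)).
- by move=> *; exact: approximable_lin.
- apply: (@represented_network (fun=> 1) 1) => [||x].
  + exact: scalar_network_cst.
  + exact: measurable_cst.
  + by rewrite normr1.
- exact: setI_closed_orthants.
- exact: measurable_orthants.
move=> _ [v _ <-].
have [M hM] := orthant_network_bounded v sh.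
have mnet n : measurable_fun [set: borelType X0]
    (orthant_network (step_combination sigma a b c) v n \o val).
  exact: (@measurable_orthant_network _ _ (borelType X0) _ _ v n val sh
    (@measurable_borelType_coord R d X X0)).
split; first exact: measurable_orthant.
apply: (represented_cvg (nu := nu) closedW _ mnet (Lfun_cst nu M 2)) => /=.
- by move=> n; apply: represented_network => //; exact: scalar_network_orthant.
- by move=> n x; exact: hM.
- by move=> x; exact: orthant_network_cvg.
Qed.

End neural_density.

Theorem theorem2p1 (R : realType) (d : nat) (X : set 'rV[R]_d)
    (X0 : X !=set0) (nu : probability (borelType X0) R)
    (L : {linear LspaceType2 nu -> LspaceType2 nu}) (sigma : R -> R) :
  compact X -> continuous L -> usual_activation sigma ->
  forall (K : set (LspaceType2 nu)) (eps : R), compact K -> 0 < eps < 1 ->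
  exists (N : nat) (phi : 'I_N -> LspaceType2 nu)
         (G : {linear 'cV[R]_N -> 'cV[R]_N}),
    let Lhat := reconstruction phi \o G \o coefficients phi in
    [/\ (0 < N)%N, neural_basis sigma phi &
        (ereal_sup [set `|L g - Lhat g|%:E | g in K] <= eps%:E)%E].
Proof.
move=> _ cL us K eps cK /andP[eps0 _].
have W0 : network_class (nu := nu) sigma !=set0.
  exists 0, (fun=> 0); [exact: scalar_network_cst|exact: Lspace0E].
have [N [phi [N0 Wphi errK]]] :=
  compact_compression W0 (neural_density us) cL cK eps0.
exists N, phi, (compression phi L); split => //.
by apply: ge_ereal_sup => _ [g Kg <-]; rewrite lee_fin; exact: errK.
Qed.
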